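(* In the setting of the context (general decay function with $0<\phi(t)\le e^{-\rho t}$, and burst separation $t_{j+1}-t_j\ge D+4\beta$), with $M\ge1$ and $a\in\mathbb R$ such that $\|T(t)\|\le Me^{at}$ for all $t\ge0$, put $$\epsilon=\frac{2}{e^{\rho D}-1}\,Me^{a\beta}HR,\qquad Q(g,\beta)=e^{(\rho+a)\beta}ML\|g\|\beta+e^{a\beta}(e^{\rho\beta}-1)MK\|g\|+4e^{\rho\beta}\sigma,$$ and let $Q_1(g,\beta)=Q(g,\beta)+\epsilon$ be the threshold in Algorithm 2 (described in the context). Let also $\mathfrak t_j$ and $\mathfrak f_j(g)$ be the outputs of Algorithm 2 for the $j$-th burst (with $\mathfrak f_j(g)=0$ if the $j$-th burst is not detected). Then $|\mathfrak t_j-t_j|\le\beta$ and $$|\mathfrak f_j(g)-\langle h_j,g\rangle|\le\epsilon+3e^{(3\rho+a)\beta}ML\|g\|\beta+e^{a\beta}(e^{3\rho\beta}-1)MK\|g\|+4e^{3\rho\beta}\sigma+2e^{\rho\beta}Q_1(g,\beta)+\max\{v_{3,2}(h_j,g,\beta),v_{3,3}(h_j,g,\beta),v_{2,2}(h_j,g,\beta)\},$$ where the $v_{k,i}$, $k,i=2,3$, are the quantities defined in the context, so that $v_{k,i}(h_j,g,\beta)\to0$ as $\beta\to0$. In particular, for sufficiently small $\beta>0$, one has $|\mathfrak f_j(g)-\langle h_j,g\rangle|\le13\sigma+4\epsilon$ as long as $\sigma$ and $\epsilon$ are not both $0$.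
   Context: Setting. $\mathcal H$ is a Hilbert space of functions on a subset of $\mathbb R^d$, $A:D(A)\subseteq\mathcal H\to\mathcal H$ generates a strongly continuous semigroup $T:[0,\infty)\to B(\mathcal H)$, and $u_0\in\mathcal H$. The decay function $\phi$ is continuous on $[0,\infty)$ with $\phi(0)=1$ and $0<\phi(t)\le e^{-\rho t}$ for some $\rho>0$. Let $0<t_1<\dots<t_N$ (burst times) and $h_1,\dots,h_N\in\mathcal H$ (burst shapes). The state $u$ is the mild solution of $$\dot u(t)=Au(t)+\sum_{j=1}^N h_j\phi(t-t_j)\chi_{[t_j,\infty)}(t)+\eta(t),\qquad u(0)=u_0,$$ that is, $u(t)=T(t)u_0+\int_0^tT(t-s)F(s)\,ds$ with $F(s)=\sum_{j=1}^N h_j\phi(s-t_j)\chi_{[t_j,\infty)}(s)+\eta(s)$. Assumptions. $\beta>0$ is the time sampling step. The set of samplers is $G=\widetilde G\cup T^*(\beta)\widetilde G$ for a countable (possibly finite) set $\widetilde G\subseteq\mathcal H$ with $R=\sup_{g\in\widetilde G}\|g\|<\infty$. The bursts are uniformly bounded: $\|h_j\|\le H$ for $j=1,\dots,N$. The background source $\eta:[0,\infty)\to\mathcal H$ satisfies $\sup_{t\ge0}\|\eta(t)\|\le K$ and $\|\eta(t+s)-\eta(t)\|\le Ls$ for all $s,t\ge0$, where $K>0$, $L\ge0$. The measurements are given by a real-valued function $\mathfrak m(t,f)=\langle u(t),f\rangle+\nu(t,f)$, where the additive noise $\nu$ satisfies $\sup_{t>0,\,f\in\mathcal H}|\nu(t,f)|\le\sigma$.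 The bursts satisfy $t_{j+1}-t_j\ge D+4\beta$, where the positive number $D$ is chosen in such a way that the quantity $\epsilon$ of the claim is small. Measurements. Write $\mathfrak m_n(f)=\mathfrak m(n\beta,f)$. For $g\in\widetilde G$ one acquires $\mathfrak m_n(\tfrac g\beta)$ and $\mathfrak m_n(\tfrac{T^*(\beta)g}{\beta})$ and puts $$F_n=\mathfrak m_{n+1}\big(\tfrac g\beta\big)-\mathfrak m_n\big(\tfrac{T^*(\beta)g}{\beta}\big),\qquad \Delta_n=e^{\rho\beta}F_{n+1}-F_n .$$ Algorithm 2 (with threshold $Q_1(g,\beta)$, parameter $D>0$ and time horizon $T_{\max}$). For each $g\in\widetilde G$: start with $i=1$. While $i\beta<T_{\max}$: if $|\Delta_i|>Q_1(g,\beta)$, output $\mathfrak f(g)=e^{3\rho\beta}F_{i+2}-F_{i-1}$ and $\mathfrak t=(i+1)\beta$, and replace $i$ by $i+3+\lfloor D/\beta\rfloor$; otherwise, if $|\Delta_{i+1}|>Q_1(g,\beta)$, output $\mathfrak f(g)=e^{3\rho\beta}F_{i+3}-F_i$ and $\mathfrak t=(i+2)\beta$, and replace $i$ by $i+3+\lfloor D/\beta\rfloor$; otherwise replace $i$ by $i+1$. When the $j$-th burst lies in $[(n+1)\beta,(n+2)\beta)$, it is detected if and only if $|\Delta_n|>Q_1(g,\beta)$ or $|\Delta_{n+1}|>Q_1(g,\beta)$. Notation. For $k,i\in\{2,3\}$, with $n$ the integer such that $t_j\in[(n+1)\beta,(n+2)\beta)$, $$v_{k,i}(h_j,g,\beta)=\left|\int_0^\beta\Big\langle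 T(\beta-s)h_je^{k\rho\beta}\phi((n+i)\beta+s-t_j),\frac g\beta\Big\rangle ds-\langle h_j,g\rangle\right| .$$
   Formalization: The explicit error bound is proved for a ≥ 0 (it can fail for a < 0; then use a = 0) and for bursts with n ≥ 2 or when the noise bound also holds at t = 0, as Algorithm 2 may use the measurement at time 0; bursts with t_j < β, where n would be negative, are excluded. *)

(* Defs.v *)
From Stdlib Require Export Reals.
From Coquelicot Require Export Coquelicot.
Open Scope R_scope.

(* A real Hilbert space is a [CompleteNormedModule R_AbsRing] whose norm is
   induced by an inner product; positive definiteness comes from the norm. *)
Record is_inner_product {V : NormedModule R_AbsRing} (ip : V -> V -> R) : Prop := {
  ip_sym : forall x y, ip x y = ip y x;
  ip_plus_l : forall x y z, ip (plus x y) z = ip x z + ip y z;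
  ip_scal_l : forall (c : R) x y, ip (scal c x) y = c * ip x y;
  ip_norm : forall x, norm x = sqrt (ip x x)
}.

(* Only the values [T t] with [0 <= t] are meaningful.  [is_linear] is
   Coquelicot's notion of a bounded linear map. *)
Record is_C0_semigroup {V : NormedModule R_AbsRing} (T : R -> V -> V) : Prop := {
  sg_bounded : forall t, 0 <= t -> is_linear (T t);
  sg_zero : forall x, T 0 x = x;
  sg_plus : forall s t x, 0 <= s -> 0 <= t -> T (s + t) x = T s (T t x);
  sg_cont : forall x, filterlim (fun t => T t x) (at_right 0) (locally x)
}.

(* [A] is an operator with domain [dom]; its values outside [dom] are irrelevant. *)
Definition is_generator {V : NormedModule R_AbsRing} (T : R -> V -> V)
    (dom : V -> Prop) (A : V -> V) : Prop :=
  let quotient x := fun t : R => scal (/ t) (minus (T t x) x) in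
  (forall x, dom x <-> exists y, filterlim (quotient x) (at_right 0) (locally y)) /\
  (forall x, dom x -> filterlim (quotient x) (at_right 0) (locally (A x))).

Definition is_adjoint {V : NormedModule R_AbsRing} (ip : V -> V -> R)
    (S Sstar : V -> V) : Prop :=
  forall x y, ip (S x) y = ip x (Sstar y).

Definition is_countable {X : Type} (P : X -> Prop) : Prop :=
  exists enum : nat -> option X, forall x, P x -> exists k, enum k = Some x.

(* One-sided at [0]. *)
Definition continuous_on_nonneg (phi : R -> R) : Prop :=
  forall t, 0 <= t ->
    filterlim phi (within (fun s => 0 <= s) (locally t)) (locally (phi t)).

(* Characteristic function of [[a, +oo)]. *)
Definition chi_from (a s : R) : R := if Rle_dec a s then 1 else 0.

(* Bursts are indexed by [1 <= j <= N]. *)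
Definition source {V : NormedModule R_AbsRing} (N : nat) (tb : nat -> R)
    (h : nat -> V) (phi : R -> R) (eta : R -> V) (s : R) : V :=
  plus (sum_n_m (fun j => scal (phi (s - tb j) * chi_from (tb j) s) (h j)) 1 N)
       (eta s).

Definition is_mild_solution {V : NormedModule R_AbsRing} (T : R -> V -> V)
    (u0 : V) (F u : R -> V) : Prop :=
  forall t, 0 <= t ->
    exists I, is_RInt (fun s => T (t - s) (F s)) 0 t I /\ u t = plus (T t u0) I.

Definition measurement {V : NormedModule R_AbsRing} (ip : V -> V -> R)
    (u : R -> V) (nu : R -> V -> R) (t : R) (f : V) : R :=
  ip (u t) f + nu t f.

Definition Fseq {V : NormedModule R_AbsRing} (m : R -> V -> R)
    (Tstar : R -> V -> V) (beta : R) (g : V) (n : nat) : R :=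
  m (INR (n + 1) * beta) (scal (/ beta) g)
  - m (INR n * beta) (scal (/ beta) (Tstar beta g)).

Definition Dseq (rho beta : R) (F : nat -> R) (n : nat) : R :=
  exp (rho * beta) * F (n + 1)%nat - F n.

(* One pass through the body of the detection loop at index [i].  An
   output [(k, t, f)] records, next to the time [t] and the value [f], the
   index [k] of the [Delta_k] that exceeded the threshold [Q]. *)
Definition alg_body (rho beta Q : R) (F : nat -> R) (i : nat)
    : option (nat * R * R) :=
  if Rlt_dec Q (Rabs (Dseq rho beta F i)) then
    Some (i, INR (i + 1) * beta,
          exp (3 * rho * beta) * F (i + 2)%nat - F (i - 1)%nat)
  else if Rlt_dec Q (Rabs (Dseq rho beta F (i + 1))) then
    Some ((i + 1)%nat, INR (i + 2) * beta,
          exp (3 * rho * beta) * F (i + 3)%nat - F i)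
  else None.

(* Values taken by the loop variable [i]; its body is executed at those
   satisfying the loop condition [i * beta < Tmax]. *)
Inductive alg_reaches (rho beta Q D Tmax : R) (F : nat -> R) : nat -> Prop :=
| alg_start : alg_reaches rho beta Q D Tmax F 1
| alg_output i r :
    alg_reaches rho beta Q D Tmax F i -> INR i * beta < Tmax ->
    alg_body rho beta Q F i = Some r ->
    alg_reaches rho beta Q D Tmax F (i + 3 + Z.to_nat (Int_part (D / beta)))
| alg_advance i :
    alg_reaches rho beta Q D Tmax F i -> INR i * beta < Tmax ->
    alg_body rho beta Q F i = None ->
    alg_reaches rho beta Q D Tmax F (i + 1).

Definition in_window (beta t : R) (n : nat) : Prop :=
  INR (n + 1) * beta <= t < INR (n + 2) * beta.

(* The detection rule for a burst in [[(n+1) beta, (n+2) beta)]. *)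
Definition detected (rho beta Q : R) (F : nat -> R) (n : nat) : Prop :=
  Q < Rabs (Dseq rho beta F n) \/ Q < Rabs (Dseq rho beta F (n + 1)).

(* Outputs (time, if any, and value) attributed to a burst in
   [[(n+1) beta, (n+2) beta)].  [out_run]: an output of the actual run
   triggered by [Delta_n] or [Delta_(n+1)].  [out_rule]: by the detection rule,
   a detected burst is served by the loop body at [i = n], whatever the loop did
   before (it might have skipped [n] or stopped at [Tmax]); this needs [1 <= n],
   the loop having no pass at [0].  [out_missed]: no detection, value [0]. *)
Inductive burst_output (rho beta Q D Tmax : R) (F : nat -> R) (n : nat)
    : option R -> R -> Prop :=
| out_run i k t f :
    alg_reaches rho beta Q D Tmax F i -> INR i * beta < Tmax ->
    alg_body rho beta Q F i = Some (k, t, f) ->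
    k = n \/ k = (n + 1)%nat ->
    burst_output rho beta Q D Tmax F n (Some t) f
| out_rule k t f :
    (1 <= n)%nat -> alg_body rho beta Q F n = Some (k, t, f) ->
    burst_output rho beta Q D Tmax F n (Some t) f
| out_missed :
    ~ detected rho beta Q F n ->
    burst_output rho beta Q D Tmax F n None 0.

Definition eps (M a beta H Rg rho D : R) : R :=
  2 / (exp (rho * D) - 1) * M * exp (a * beta) * H * Rg.

(* [ng] stands for the norm of [g]. *)
Definition Qthr (M a beta rho L K sigma ng : R) : R :=
  exp ((rho + a) * beta) * M * L * ng * beta
  + exp (a * beta) * (exp (rho * beta) - 1) * M * K * ng
  + 4 * exp (rho * beta) * sigma.

Definition vdev {V : NormedModule R_AbsRing} (ip : V -> V -> R)
    (T : R -> V -> V) (phi : R -> R) (rho beta tj : R) (n k i : nat)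
    (hj g : V) : R :=
  Rabs (RInt (fun s =>
          ip (T (beta - s)
                (scal (exp (INR k * rho * beta)
                       * phi (INR (n + i) * beta + s - tj)) hj))
             (scal (/ beta) g)) 0 beta
        - ip hj g).

(* Main.v *)
(** Put [W_n = int_0^b <T(b-s) F(nb+s), g/b> ds].  By the variation of constants
    formula and the adjoint, [F_n] is [W_n] up to the noise [2 sigma].  Take a
    sample interval before [t_j] and one after it, [k] steps later, and consider
    [e^(k rho b) W_(m+k) - W_m].  As [phi(t) <= e^(-rho t)], the weight does not let
    an older burst grow, so the [i]-th burst with [i < j] contributes at most
    [M e^(ab) H |g| e^(-(j-i) rho D)], a geometric series; later bursts vanish; the
    background contributes through its Lipschitz constant and [e^(k rho b) - 1];
    and the [j]-th burst itself is [<h_j, g>] up to [v_(k,i)].  Outputs have [k = 3].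
    For a missed burst, [e^(rho b) Delta_(n+1) + Delta_n = e^(2 rho b) F_(n+2) - F_n]
    is small, so [k = 2] shows that [<h_j, g>] is itself small. *)

Require Import Defs.
From Corelib Require Import ssreflect.
From Stdlib Require Import Reals Lra Lia.
From Coquelicot Require Import Coquelicot.
Open Scope R_scope.

(** * Inner products and the Cauchy-Schwarz inequality *)

Section InnerProduct.

Context {V : NormedModule R_AbsRing} (ip : V -> V -> R) (Hip : is_inner_product ip).

Lemma ip_zero_l (x : V) : ip zero x = 0.
Proof.
  pose proof (ip_plus_l _ Hip zero zero x) as H0. rewrite plus_zero_l in H0. lra.
Qed.

Lemma ip_scal_r (c : R) (x y : V) : ip x (scal c y) = c * ip x y.
Proof. rewrite (ip_sym _ Hip) (ip_scal_l _ Hip) (ip_sym _ Hip). reflexivity. Qed.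

Lemma ip_plus_r (x y z : V) : ip x (plus y z) = ip x y + ip x z.
Proof.
  rewrite (ip_sym _ Hip) (ip_plus_l _ Hip) !(ip_sym _ Hip x). reflexivity.
Qed.

Lemma ip_minus_l (x y z : V) : ip (minus x y) z = ip x z - ip y z.
Proof.
  assert (H0 : ip zero z = ip (opp y) z + ip y z).
  { rewrite -(ip_plus_l _ Hip). apply (f_equal (fun x => ip x z)).
    symmetry. exact (plus_opp_l y). }
  rewrite ip_zero_l in H0.
  unfold minus. rewrite (ip_plus_l _ Hip). lra.
Qed.

(** Positivity comes out of [ip_norm]: if [ip x x] were negative, [sqrt] would return 0, so [x]
    would be [zero] and [ip x x] would vanish after all. *)
Lemma ip_self (x : V) : ip x x = norm x * norm x.
Proof.
  destruct (Rle_dec 0 (ip x x)) as [Hx | Hx].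
  - rewrite (ip_norm _ Hip). symmetry. now apply sqrt_def.
  - assert (Hn : norm x = 0) by (rewrite (ip_norm _ Hip); apply sqrt_neg_0; lra).
    rewrite Hn (norm_eq_zero x Hn) ip_zero_l. ring.
Qed.

Lemma cauchy_schwarz (x y : V) : Rabs (ip x y) <= norm x * norm y.
Proof.
  pose proof (norm_ge_0 x) as Hx. pose proof (norm_ge_0 y) as Hy.
  destruct Hy as [Hy | Hy].
  (* This [c] minimises the norm of [plus x (scal c y)]; the squared norm there equals
     [norm x * norm x + c * ip x y]. *)
  - set (c := - ip x y / (norm y * norm y)).
    assert (Hz := ip_self (plus x (scal c y))).
    rewrite (ip_plus_l _ Hip) !ip_plus_r !(ip_scal_l _ Hip) !ip_scal_r (ip_sym _ Hip y x)
      !ip_self in Hz.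
    assert (Hc : c * (norm y * norm y) = - ip x y) by (unfold c; field; lra).
    assert (H0 : 0 <= norm x * norm x + c * ip x y).
    { pose proof (Rle_0_sqr (norm (plus x (scal c y)))) as H0. unfold Rsqr in H0.
      nra. }
    apply Rsqr_incr_0_var; [| nra].
    rewrite -Rsqr_abs. unfold Rsqr.
    assert (0 <= (norm x * norm x + c * ip x y) * (norm y * norm y)) by
      (apply Rmult_le_pos; nra).
    nra.
  - symmetry in Hy. rewrite (norm_eq_zero y Hy) (ip_sym _ Hip) ip_zero_l Rabs_R0 norm_zero.
    lra.
Qed.

Lemma is_linear_ip (y : V) : is_linear (fun x => ip x y).
Proof.
  split.
  - intros x z. apply (ip_plus_l _ Hip).
  - intros c x. apply (ip_scal_l _ Hip).
  (* [is_linear] asks for a strictly positive bound, hence the [+ 1], which covers [norm y = 0]. *)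
  - exists (norm y + 1). pose proof (norm_ge_0 y) as Hy. split; [lra |].
    intros x. pose proof (norm_ge_0 x). change (Rabs (ip x y) <= (norm y + 1) * norm x).
    pose proof (cauchy_schwarz x y). nra.
Qed.

End InnerProduct.

(** * Integrals under bounded linear maps, group identities and elementary real bounds *)

Lemma Riemann_sum_linear {U V : NormedModule R_AbsRing} (l : U -> V) (f : R -> U) (ptd : SF_seq) :
  is_linear l -> Riemann_sum (fun x => l (f x)) ptd = l (Riemann_sum f ptd).
Proof.
  intros Hl. induction ptd as [x0 | h0 ptd IH] using SF_cons_ind.
  - symmetry. exact (linear_zero l Hl).
  - rewrite !Riemann_sum_cons IH (linear_plus l Hl) (linear_scal l Hl). reflexivity.
Qed.

Lemma is_RInt_linear {U V : NormedModule R_AbsRing} (l : U -> V) (f : R -> U) (a b : R) (I : U) :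
  is_linear l -> is_RInt f a b I -> is_RInt (fun x => l (f x)) a b (l I).
Proof.
  intros Hl Hf. unfold is_RInt in *.
  apply filterlim_ext with
    (fun ptd => l (scal (sign (b - a)) (Riemann_sum f ptd))).
  - intros ptd. rewrite (linear_scal l Hl) (Riemann_sum_linear l f ptd Hl). reflexivity.
  - apply filterlim_comp with (1 := Hf). now apply linear_cont.
Qed.

Lemma minus_plus_l {G : AbelianGroup} (x y z : G) : plus z y = x -> z = minus x y.
Proof.
  move=> <-. by rewrite /minus -plus_assoc plus_opp_r plus_zero_r.
Qed.

Lemma minus_plus_cancel {G : AbelianGroup} (x y : G) : plus (minus x y) y = x.
Proof.
  by rewrite /minus -plus_assoc plus_opp_l plus_zero_r.
Qed.

Lemma minus_plus_plus {G : AbelianGroup} (x y z : G) :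
  minus (plus x (plus y z)) (plus x y) = z.
Proof.
  symmetry. apply: minus_plus_l. by rewrite (plus_comm z) plus_assoc.
Qed.

Lemma norm_minus_sym {V : NormedModule R_AbsRing} (x y : V) :
  norm (minus x y) = norm (minus y x).
Proof. rewrite -norm_opp. f_equal. apply opp_minus. Qed.

Lemma linear_minus {U V : NormedModule R_AbsRing} (l : U -> V) (x y : U) :
  is_linear l -> l (minus x y) = minus (l x) (l y).
Proof.
  intros Hl. apply minus_plus_l.
  rewrite -(linear_plus l Hl). exact (f_equal l (minus_plus_cancel x y)).
Qed.

Lemma exp_le_exp (x y : R) : x <= y -> exp x <= exp y.
Proof. intros [Hxy | ->]; [left; now apply exp_increasing | apply Rle_refl]. Qed.

Lemma Rmax_l_lipschitz (c x y : R) : Rabs (Rmax c x - Rmax c y) <= Rabs (x - y).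
Proof.
  unfold Rmax. destruct (Rle_dec c x), (Rle_dec c y); unfold Rabs;
    repeat destruct Rcase_abs; lra.
Qed.

(** Extending [phi] by the value [phi 0] to negative arguments turns one-sided continuity at 0 into
    continuity on the whole line, the form from which integrability is derived later. *)
Lemma continuous_on_nonneg_Rmax (phi : R -> R) (t : R) :
  continuous_on_nonneg phi -> continuous (fun s => phi (Rmax 0 s)) t.
Proof.
  intros Hphi. apply filterlim_locally. intros e.
  destruct (proj1 (filterlim_locally phi (phi (Rmax 0 t)))
    (Hphi (Rmax 0 t) (Rmax_l 0 t)) e) as [d Hd].
  exists d. intros s Hs. apply Hd; [| apply Rmax_l].
  apply Rle_lt_trans with (2 := Hs). apply Rmax_l_lipschitz.
Qed.

(** * Variation of constants and strong continuity of orbits *)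

Section Semigroup.

Context {V : CompleteNormedModule R_AbsRing} (T : R -> V -> V) (HT : is_C0_semigroup T).

(** Split the integral that defines [u (p + b)] at [p]. On [[0, p]] the semigroup law factors out
    [T b], so that part together with [T (p + b) u0] is [T b (u p)]; what remains is the integral
    over [[p, p + b]], shifted to [[0, b]]. *)
Lemma mild_solution_increment (u0 : V) (F u : R -> V) (p b : R) :
  is_mild_solution T u0 F u -> 0 <= p -> 0 <= b ->
  is_RInt (fun s => T (b - s) (F (p + s))) 0 b (minus (u (p + b)) (T b (u p))).
Proof.
  intros Hu Hp Hb.
  destruct (Hu p Hp) as [I0 [HI0 E0]].
  assert (Hpb : 0 <= p + b) by lra.
  destruct (Hu (p + b) Hpb) as [I1 [HI1 E1]].
  assert (Hlow : is_RInt (fun s => T (p + b - s) (F s)) 0 p (T b I0)).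
  { apply is_RInt_ext with (2 := is_RInt_linear (T b) _ 0 p I0 (sg_bounded _ HT b Hb) HI0).
    rewrite Rmin_left ?Rmax_right; try lra. intros s Hs.
    rewrite -(sg_plus _ HT); try lra. f_equal. ring. }
  destruct (ex_RInt_Chasles_2 (fun s => T (p + b - s) (F s)) 0 p (p + b)) as [J HJ];
    [lra | now exists I1 |].
  assert (E : I1 = plus (T b I0) J).
  { rewrite -(is_RInt_unique _ _ _ _ HI1).
    apply is_RInt_unique, is_RInt_Chasles with (1 := Hlow) (2 := HJ). }
  rewrite E1 E0 E (linear_plus _ (sg_bounded _ HT b Hb)) -(sg_plus _ HT) ?(Rplus_comm b p);
    try lra.
  rewrite (minus_plus_plus (T (p + b) u0) (T b I0) J).
  (* The substitution rule for [1 * s + p] carries the slope as a factor [scal 1], which is inserted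
     beforehand. *)
  apply is_RInt_ext with (fun s => scal 1 (T (p + b - (1 * s + p)) (F (1 * s + p)))).
  - intros s _. rewrite scal_one. f_equal; [ring | f_equal; ring].
  - apply (is_RInt_comp_lin (fun s => T (p + b - s) (F s))).
    replace (1 * 0 + p) with p by ring. replace (1 * b + p) with (p + b) by ring. exact HJ.
Qed.

Lemma semigroup_right_modulus (x : V) (e : R) : 0 < e ->
  exists d, 0 < d /\ forall t, 0 <= t < d -> norm (minus (T t x) x) < e.
Proof.
  intros He.
  destruct (proj1 (filterlim_locally_ball_norm _ _) (sg_cont _ HT x) (mkposreal e He))
    as [d Hd].
  (* [at_right 0] excludes [t = 0], where [sg_zero] makes the difference vanish. *)
  exists d. split; [apply cond_pos |]. intros t [[Ht | <-] Htd].
  - apply Hd; [| exact Ht]. change (Rabs (t - 0) < d).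
    rewrite Rminus_0_r Rabs_pos_eq; lra.
  - rewrite (sg_zero _ HT). rewrite minus_eq_zero norm_zero. exact He.
Qed.

Context (M a : R) (HM : 0 <= M)
  (Hgrowth : forall t x, 0 <= t -> norm (T t x) <= M * exp (a * t) * norm x).

Lemma semigroup_increment_bound (s d : R) (x : V) : 0 <= s -> 0 <= d ->
  norm (minus (T (s + d) x) (T s x)) <= M * exp (a * s) * norm (minus (T d x) x).
Proof.
  intros Hs Hd. rewrite (sg_plus _ HT) //.
  rewrite -(linear_minus _ _ _ (sg_bounded _ HT s Hs)). now apply Hgrowth.
Qed.

(** Strong continuity at 0 spreads along the orbit: for times [r] and [r + q] the difference is
    [T r] applied to [minus (T q x) x], and [T r] is uniformly bounded for [r] up to [Rabs t0 + 1].
    Taking the smaller time as [r] gives continuity from both sides. *)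
Lemma orbit_continuous (x : V) (t0 : R) : continuous (fun t => T (Rmax 0 t) x) t0.
Proof.
  apply (proj2 (filterlim_locally_ball_norm (U := V) (F := locally t0) _ _)). intros e.
  (* [B] dominates [M * exp (a * r)] for [0 <= r <= Rabs t0 + 1], whatever the sign of [a]; the
     [+ 1] makes it positive. *)
  set (B := M * exp (Rabs a * (Rabs t0 + 1)) + 1).
  assert (HB : 0 < B).
  { pose proof (exp_pos (Rabs a * (Rabs t0 + 1))). unfold B. nra. }
  destruct (semigroup_right_modulus x (e / B)) as [d [Hd0 Hd]].
  { apply Rdiv_lt_0_compat; [apply cond_pos | exact HB]. }
  assert (Hd1 : 0 < Rmin d 1) by (apply Rmin_glb_lt; lra).
  assert (Hmain : forall r q, 0 <= r -> r <= Rabs t0 + 1 -> 0 <= q < d ->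
    norm (minus (T (r + q) x) (T r x)) < e).
  { intros r q Hr Hr1 Hq.
    apply Rle_lt_trans with (1 := semigroup_increment_bound r q x Hr (proj1 Hq)).
    specialize (Hd q Hq). pose proof (norm_ge_0 (minus (T q x) x)).
    apply Rle_lt_trans with (B * norm (minus (T q x) x)).
    - apply Rmult_le_compat_r; [assumption |]. unfold B.
      assert (exp (a * r) <= exp (Rabs a * (Rabs t0 + 1))).
      { apply exp_le_exp. pose proof (Rle_abs a). pose proof (Rabs_pos a).
        apply Rle_trans with (Rabs a * r); [nra | nra]. }
      nra.
    - apply Rlt_le_trans with (B * (e / B)); [nra |]. apply Req_le. field. lra. }
  exists (mkposreal _ Hd1). intros t Ht.
  change (Rabs (t - t0) < Rmin d 1) in Ht.
  change (norm (minus (T (Rmax 0 t) x) (T (Rmax 0 t0) x)) < e).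
  pose proof (Rmax_l_lipschitz 0 t t0) as HL.
  pose proof (Rmin_l d 1). pose proof (Rmin_r d 1).
  pose proof (Rmax_l 0 t). pose proof (Rmax_l 0 t0).
  assert (Rmax 0 t0 <= Rabs t0) by
    (apply Rmax_lub; [apply Rabs_pos | apply Rle_abs]).
  destruct (Rle_dec (Rmax 0 t) (Rmax 0 t0)) as [Hle | Hle].
  - rewrite norm_minus_sym.
    replace (Rmax 0 t0) with (Rmax 0 t + (Rmax 0 t0 - Rmax 0 t)) by ring.
    rewrite Rabs_left1 in HL; try lra. apply Hmain; lra.
  - replace (Rmax 0 t) with (Rmax 0 t0 + (Rmax 0 t - Rmax 0 t0)) by ring.
    rewrite Rabs_pos_eq in HL; try lra. apply Hmain; lra.
Qed.

End Semigroup.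

(** * Finite sums, burst separation and the source under a functional *)

Lemma linear_sum_n_m {U V : NormedModule R_AbsRing} (l : U -> V) (f : nat -> U) (n m : nat) :
  is_linear l -> (n <= S m)%nat ->
  l (sum_n_m f n m) = sum_n_m (fun i => l (f i)) n m.
Proof.
  intros Hl. induction m as [| m IH]; intros Hnm.
  - destruct n as [| [| n]]; [| | lia].
    + rewrite !sum_n_n. reflexivity.
    + rewrite !sum_n_m_zero; [apply (linear_zero l Hl) | lia | lia].
  - destruct (Nat.eq_dec n (S (S m))) as [-> | Hne].
    + rewrite !sum_n_m_zero; [apply (linear_zero l Hl) | lia | lia].
    + rewrite !sum_n_Sm; try lia. rewrite (linear_plus l Hl) IH; [reflexivity | lia].
Qed.

Lemma sum_n_m_zero_tail {G : AbelianMonoid} (f : nat -> G) (n m k : nat) :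
  (n <= S m)%nat -> (m <= k)%nat ->
  (forall i, (m < i <= k)%nat -> f i = zero) -> sum_n_m f n k = sum_n_m f n m.
Proof.
  intros Hnm Hmk Hf. rewrite (sum_n_m_Chasles f n m k Hnm Hmk).
  rewrite (sum_n_m_ext_loc f (fun _ => zero) (S m) k).
  - rewrite sum_n_m_const_zero plus_zero_r. reflexivity.
  - intros i Hi. apply Hf. lia.
Qed.

Lemma exp_pow_INR (x : R) (n : nat) : exp x ^ n = exp (INR n * x).
Proof.
  induction n as [| n IH].
  - simpl. rewrite Rmult_0_l exp_0. reflexivity.
  - rewrite S_INR -tech_pow_Rmult IH -exp_plus. f_equal. ring.
Qed.

(** The exponents run from [m] down to 1, so the sum stays below [C] times the full series
    [r + r^2 + ...]. [C] is kept general in the induction because dropping the last term replaces it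
    by [C * r]. *)
Lemma geometric_sum_bound (f : nat -> R) (r C : R) (m : nat) :
  0 <= r < 1 -> 0 <= C ->
  (forall i, (1 <= i <= m)%nat -> Rabs (f i) <= C * r ^ (m + 1 - i)) ->
  Rabs (sum_n_m f 1 m) <= C * (r / (1 - r)).
Proof.
  intros Hr. assert (Hq : 0 <= r / (1 - r)).
  { apply Rmult_le_pos; [lra |]. left. apply Rinv_0_lt_compat. lra. }
  revert C. induction m as [| m IH]; intros C HC Hf.
  - rewrite sum_n_m_zero; [| lia]. change (Rabs 0 <= C * (r / (1 - r))).
    rewrite Rabs_R0. nra.
  - rewrite sum_n_Sm; [| lia].
    change (Rabs (sum_n_m f 1 m + f (S m)) <= C * (r / (1 - r))).
    apply Rle_trans with (1 := Rabs_triang _ _).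
    assert (H1 : Rabs (sum_n_m f 1 m) <= C * r * (r / (1 - r))).
    { apply IH; [nra |]. intros i Hi.
      replace (C * r * r ^ (m + 1 - i)) with (C * r ^ (S m + 1 - i)).
      - apply Hf. lia.
      - replace (S m + 1 - i)%nat with (S (m + 1 - i)) by lia. simpl. ring. }
    assert (H2 : Rabs (f (S m)) <= C * r).
    { replace (C * r) with (C * r ^ (S m + 1 - S m)); [apply Hf; lia |].
      replace (S m + 1 - S m)%nat with 1%nat by lia. ring. }
    replace (C * (r / (1 - r))) with (C * r * (r / (1 - r)) + C * r) by (field; lra).
    lra.
Qed.

(** Telescoping of the gaps. With [d = D + 4 * b] it yields the geometric decay of old bursts, with
    [d = 0] the monotonicity of the burst times. *)
Lemma separated_distance (N : nat) (tb : nat -> R) (d : R) :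
  (forall j, (1 <= j < N)%nat -> d <= tb (j + 1)%nat - tb j) ->
  forall i j, (1 <= i <= j)%nat -> (j <= N)%nat -> INR (j - i) * d <= tb j - tb i.
Proof.
  intros Hsep i j Hij. induction j as [| j IH]; intros HjN; [lia |].
  destruct (Nat.eq_dec i (S j)) as [-> | Hne].
  - rewrite Nat.sub_diag. simpl. lra.
  - replace (S j - i)%nat with (S (j - i)) by lia. rewrite S_INR.
    specialize (Hsep j). replace (j + 1)%nat with (S j) in Hsep by lia.
    assert (INR (j - i) * d <= tb j - tb i) by (apply IH; lia).
    assert (d <= tb (S j) - tb j) by (apply Hsep; lia).
    lra.
Qed.

Lemma chi_from_1 (t s : R) : t <= s -> chi_from t s = 1.
Proof. intros Hs. unfold chi_from. destruct (Rle_dec t s); [reflexivity | lra]. Qed.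

Lemma chi_from_0 (t s : R) : s < t -> chi_from t s = 0.
Proof. intros Hs. unfold chi_from. destruct (Rle_dec t s); [lra | reflexivity]. Qed.

Lemma linear_source {V : NormedModule R_AbsRing} (l : V -> R) (N : nat) (tb : nat -> R)
    (h : nat -> V) (phi : R -> R) (eta : R -> V) (s : R) :
  is_linear (V := R_NormedModule) l ->
  l (source N tb h phi eta s)
  = sum_n_m (fun i => phi (s - tb i) * chi_from (tb i) s * l (h i)) 1 N + l (eta s).
Proof.
  intros Hl. unfold source. rewrite (linear_plus l Hl).
  rewrite (linear_sum_n_m l _ 1 N Hl); [| lia].
  change (sum_n_m (fun i => l (scal (phi (s - tb i) * chi_from (tb i) s) (h i))) 1 N + l (eta s)
    = sum_n_m (fun i => phi (s - tb i) * chi_from (tb i) s * l (h i)) 1 N + l (eta s)).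
  f_equal. apply sum_n_m_ext. intros i. apply (linear_scal l Hl).
Qed.

(** * Pointwise jump of the source across a burst *)

Section Bursts.

Context {V : NormedModule R_AbsRing} (phi : R -> R) (rho : R) (N : nat) (tb : nat -> R)
  (h : nat -> V) (H : R) (eta : R -> V) (K L D : R).
Hypotheses (Hrho : 0 < rho) (HD : 0 < D) (HK : 0 < K) (HL : 0 <= L)
  (Hphi : forall t, 0 <= t -> 0 < phi t <= exp (- rho * t))
  (Hh : forall j, (1 <= j <= N)%nat -> norm (h j) <= H)
  (HetaK : forall t, 0 <= t -> norm (eta t) <= K)
  (HetaL : forall t s, 0 <= t -> 0 <= s -> norm (minus (eta (t + s)) (eta t)) <= L * s).

(** The difference is [exp (rho * tau)] times the increment of [eta], controlled by [L], plus
    [exp (rho * tau) - 1] times the earlier value, controlled by [K]. *)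
Lemma background_jump_bound (l : V -> R) (C x tau : R) :
  is_linear (V := R_NormedModule) l -> 0 <= C -> (forall x, Rabs (l x) <= C * norm x) ->
  0 <= x -> 0 <= tau ->
  Rabs (exp (rho * tau) * l (eta (x + tau)) - l (eta x))
  <= C * (exp (rho * tau) * L * tau + (exp (rho * tau) - 1) * K).
Proof.
  intros Hl HC HlC Hx Ht.
  assert (He : 1 <= exp (rho * tau)) by (rewrite -exp_0; apply exp_le_exp; nra).
  pose proof (linear_minus l (eta (x + tau)) (eta x) Hl) as Hm.
  change (l (minus (eta (x + tau)) (eta x)) = l (eta (x + tau)) - l (eta x)) in Hm.
  replace (exp (rho * tau) * l (eta (x + tau)) - l (eta x))
    with (exp (rho * tau) * l (minus (eta (x + tau)) (eta x)) + (exp (rho * tau) - 1) * l (eta x))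
    by (rewrite Hm; ring).
  apply Rle_trans with (1 := Rabs_triang _ _). rewrite !Rabs_mult.
  rewrite (Rabs_pos_eq (exp (rho * tau))); [| lra].
  rewrite (Rabs_pos_eq (exp (rho * tau) - 1)); [| lra].
  assert (H1 : Rabs (l (minus (eta (x + tau)) (eta x))) <= C * (L * tau)).
  { apply Rle_trans with (1 := HlC _). apply Rmult_le_compat_l; auto. }
  assert (H2 : Rabs (l (eta x)) <= C * K).
  { apply Rle_trans with (1 := HlC _). apply Rmult_le_compat_l; auto. }
  nra.
Qed.

(* The weight [exp (rho * tau)] makes the later value of an old burst at most
   the bound on its earlier value; both are nonnegative, so they partly cancel. *)
Lemma old_burst_jump_bound (t x tau : R) : 0 <= t -> t <= x -> 0 <= tau ->
  Rabs (exp (rho * tau) * phi (x + tau) - phi x) <= exp (- rho * t).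
Proof.
  intros Ht Hx Htau.
  assert (Hx0 : 0 <= x) by lra. assert (Hx1 : 0 <= x + tau) by lra.
  pose proof (Hphi x Hx0) as [P0 P1]. pose proof (Hphi (x + tau) Hx1) as [P2 P3].
  pose proof (exp_pos (rho * tau)) as Pe.
  assert (E : exp (rho * tau) * exp (- rho * (x + tau)) = exp (- rho * x)).
  { rewrite -exp_plus. f_equal. ring. }
  assert (exp (- rho * x) <= exp (- rho * t)) by (apply exp_le_exp; nra).
  assert (0 < exp (rho * tau) * phi (x + tau)) by (apply Rmult_lt_0_compat; lra).
  assert (exp (rho * tau) * phi (x + tau) <= exp (- rho * x)) by (rewrite -E; nra).
  apply Rabs_le. lra.
Qed.

(** The [4 * b] in the separation pays for both margins: at [x], at most [3 * b] before burst [j], a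
    burst [i < j] has age at least [(j - i) * D], and at [x + tau], less than [4 * b] after burst
    [j], no later burst has started. *)
Lemma source_jump_bound (l : V -> R) (C b x tau : R) (j : nat) :
  is_linear (V := R_NormedModule) l -> 0 <= C -> (forall x, Rabs (l x) <= C * norm x) ->
  (forall j, (1 <= j < N)%nat -> D + 4 * b <= tb (j + 1)%nat - tb j) ->
  0 <= b -> (1 <= j <= N)%nat -> 0 <= x -> tb j - 3 * b <= x < tb j ->
  0 <= tau -> tb j <= x + tau < tb j + 4 * b ->
  Rabs (exp (rho * tau) * l (source N tb h phi eta (x + tau)) - l (source N tb h phi eta x)
        - exp (rho * tau) * phi (x + tau - tb j) * l (h j))
  <= C * (H / (exp (rho * D) - 1) + exp (rho * tau) * L * tau + (exp (rho * tau) - 1) * K).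
Proof.
  intros Hl HC HlC Hsep Hb Hj Hx0 Hx Ht Hxt.
  pose proof (separated_distance N tb _ Hsep) as Hdist.
  rewrite !(linear_source l N tb h phi eta _ Hl).
  set (c := fun i => exp (rho * tau) * (phi (x + tau - tb i) * chi_from (tb i) (x + tau) * l (h i))
                     - phi (x - tb i) * chi_from (tb i) x * l (h i)).
  set (S1 := sum_n_m _ 1 N). set (S0 := sum_n_m _ 1 N).
  assert (ES : exp (rho * tau) * S1 - S0 = sum_n_m c 1 N).
  { unfold S1, S0. clear. induction N as [| N' IH].
    - rewrite !sum_n_m_zero; try lia. change (exp (rho * tau) * 0 - 0 = 0). ring.
    - rewrite !sum_n_Sm; try lia. change plus with Rplus. rewrite -IH. unfold c. ring. }
  assert (Ec : sum_n_m c 1 N = sum_n_m c 1 (j - 1) + c j).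
  { rewrite (sum_n_m_zero_tail c 1 j N); try lia.
    - replace j with (S (j - 1)) at 1 by lia. rewrite sum_n_Sm; [| lia].
      replace (S (j - 1)) with j by lia. reflexivity.
    - intros i Hi. unfold c.
      assert (Hd : INR (i - j) * (D + 4 * b) <= tb i - tb j) by (apply Hdist; lia).
      assert (1 <= INR (i - j)) by (apply (le_INR 1); lia).
      assert (x + tau < tb i) by nra.
      change (exp (rho * tau) * (phi (x + tau - tb i) * chi_from (tb i) (x + tau) * l (h i))
        - phi (x - tb i) * chi_from (tb i) x * l (h i) = 0).
      rewrite !chi_from_0; lra. }
  (* Burst [j] has not begun at [x], so only its later term remains. *)
  assert (Ej : c j = exp (rho * tau) * phi (x + tau - tb j) * l (h j)).
  { unfold c. rewrite chi_from_1 ?chi_from_0; lra. }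
  set (r := exp (- rho * D)).
  assert (Hr : 0 <= r < 1).
  { unfold r. split; [left; apply exp_pos |]. rewrite -exp_0. apply exp_increasing. nra. }
  assert (HH : 0 <= H) by
    (apply Rle_trans with (2 := Hh j Hj); apply norm_ge_0).
  assert (Hold : Rabs (sum_n_m c 1 (j - 1)) <= C * H * (r / (1 - r))).
  { apply geometric_sum_bound; [exact Hr | nra |]. intros i Hi.
    assert (Hd : INR (j - i) * (D + 4 * b) <= tb j - tb i) by (apply Hdist; lia).
    assert (Hji : 1 <= INR (j - i)) by (apply (le_INR 1); lia).
    assert (HiD : 0 <= INR (j - i) * D) by nra.
    assert (HiDx : INR (j - i) * D <= x - tb i) by nra.
    unfold c. rewrite !chi_from_1; try lra.
    replace (exp (rho * tau) * (phi (x + tau - tb i) * 1 * l (h i)) - phi (x - tb i) * 1 * l (h i))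
      with ((exp (rho * tau) * phi (x - tb i + tau) - phi (x - tb i)) * l (h i))
      by (replace (x + tau - tb i) with (x - tb i + tau) by ring; ring).
    rewrite Rabs_mult (Rmult_comm (C * H)). apply Rmult_le_compat; try apply Rabs_pos.
    - apply Rle_trans with (1 := old_burst_jump_bound _ _ _ HiD HiDx Ht).
      unfold r. rewrite exp_pow_INR. apply Req_le. f_equal.
      replace (j - 1 + 1 - i)%nat with (j - i)%nat by lia. ring.
    - apply Rle_trans with (1 := HlC _). apply Rmult_le_compat_l; [exact HC |].
      apply Hh. lia. }
  (* This turns the sum of the series into the constant that occurs in [eps]. *)
  assert (Er : r / (1 - r) = / (exp (rho * D) - 1)).
  { assert (1 < exp (rho * D)) by (rewrite -exp_0; apply exp_increasing; nra).
    unfold r. replace (- rho * D) with (- (rho * D)) by ring. rewrite exp_Ropp.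
    field. repeat split; lra. }
  rewrite Er in Hold.
  pose proof (background_jump_bound l C x tau Hl HC HlC Hx0 Ht) as Hbg.
  replace (exp (rho * tau) * (S1 + l (eta (x + tau))) - (S0 + l (eta x))
           - exp (rho * tau) * phi (x + tau - tb j) * l (h j))
    with (sum_n_m c 1 (j - 1) + (exp (rho * tau) * l (eta (x + tau)) - l (eta x)))
    by (rewrite -Ej; lra).
  apply Rle_trans with (1 := Rabs_triang _ _). unfold Rdiv. nra.
Qed.

End Bursts.

(** * Outputs of the detection loop, and two elementary bounds *)

Lemma alg_reaches_pos (rho b Q D Tmax : R) (F : nat -> R) (i : nat) :
  alg_reaches rho b Q D Tmax F i -> (1 <= i)%nat.
Proof. intros Hi. induction Hi; lia. Qed.

(** In terms of the triggering index [k] both branches yield one formula, built on the samples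
    [k - 1] and [k + 2]. *)
Lemma alg_body_output (rho b Q : R) (F : nat -> R) (i k : nat) (t f : R) :
  (1 <= i)%nat -> alg_body rho b Q F i = Some (k, t, f) ->
  (k = i \/ k = (i + 1)%nat) /\ t = INR (k + 1) * b
  /\ f = exp (3 * rho * b) * F (k + 2)%nat - F (k - 1)%nat.
Proof.
  intros Hi. unfold alg_body.
  destruct (Rlt_dec _ _); [| destruct (Rlt_dec _ _)]; intros E; inversion E; subst.
  - auto.
  - replace (i + 1 + 1)%nat with (i + 2)%nat by lia.
    replace (i + 1 + 2)%nat with (i + 3)%nat by lia.
    replace (i + 1 - 1)%nat with i by lia. auto.
Qed.

(** [1 <= k] is recorded so that the natural-number difference [k - 1] is a true predecessor. *)
Lemma burst_output_cases (rho b Q D Tmax : R) (F : nat -> R) (n : nat) (ot : option R) (f : R) :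
  burst_output rho b Q D Tmax F n ot f ->
  (exists k, (1 <= k)%nat /\ (k = n \/ k = (n + 1)%nat) /\ ot = Some (INR (k + 1) * b)
     /\ f = exp (3 * rho * b) * F (k + 2)%nat - F (k - 1)%nat)
  \/ (~ detected rho b Q F n /\ ot = None /\ f = 0).
Proof.
  intros [i k t f' Hreach _ Hbody Hk | k t f' Hn Hbody | Hnd].
  - left. pose proof (alg_reaches_pos _ _ _ _ _ _ _ Hreach) as Hi.
    destruct (alg_body_output _ _ _ _ _ _ _ _ Hi Hbody) as [Hki [-> ->]].
    exists k. repeat split; auto. lia.
  - left. destruct (alg_body_output _ _ _ _ _ _ _ _ Hn Hbody) as [Hki [-> ->]].
    exists k. repeat split; auto. lia.
  - right. auto.
Qed.

(** The two possible output times are the endpoints of the window that contains [t]. *)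
Lemma window_output_time (b t : R) (n k : nat) :
  in_window b t n -> k = n \/ k = (n + 1)%nat -> Rabs (INR (k + 1) * b - t) <= b.
Proof.
  unfold in_window. rewrite !plus_INR. simpl. intros Hw [-> | ->]; rewrite ?plus_INR; simpl;
    apply Rabs_le; lra.
Qed.

(** At [s = b] a sampling interval may already touch the burst time, so the bound is asked on the
    open interval only. *)
Lemma is_RInt_abs_le (f : R -> R) (b B I : R) :
  0 <= b -> is_RInt f 0 b I -> (forall s, 0 < s < b -> Rabs (f s) <= B) -> Rabs I <= b * B.
Proof.
  intros Hb Hf HB. apply Rabs_le. split.
  - assert (Hc := is_RInt_const 0 b (- B)).
    change (is_RInt (fun _ => - B) 0 b ((b - 0) * - B)) in Hc.
    assert ((b - 0) * - B <= I).
    { apply (is_RInt_le _ _ _ _ _ _ Hb Hc Hf). intros s Hs.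
      exact (proj1 (proj1 (Rabs_le_between _ _) (HB s Hs))). }
    lra.
  - assert (Hc := is_RInt_const 0 b B).
    change (is_RInt (fun _ => B) 0 b ((b - 0) * B)) in Hc.
    assert (I <= (b - 0) * B).
    { apply (is_RInt_le _ _ _ _ _ _ Hb Hf Hc). intros s Hs.
      exact (proj2 (proj1 (Rabs_le_between _ _) (HB s Hs))). }
    lra.
Qed.

Lemma norm_scal_inv_le {V : NormedModule R_AbsRing} (b : R) (g : V) :
  0 < b -> norm (scal (/ b) g) <= / b * norm g.
Proof.
  intros Hb. apply Rle_trans with (1 := norm_scal (K := R_AbsRing) (/ b) g).
  change (Rabs (/ b) * norm g <= / b * norm g).
  rewrite Rabs_pos_eq; [apply Rle_refl |]. left. now apply Rinv_0_lt_compat.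
Qed.

(** * Measured samples as integrals over sampling intervals *)

Section Measurements.

Context {V : CompleteNormedModule R_AbsRing} (ip : V -> V -> R) (T Tstar : R -> V -> V)
  (phi : R -> R) (rho M a : R).
Hypotheses (Hip : is_inner_product ip) (HT : is_C0_semigroup T)
  (Hadj : forall t, 0 <= t -> is_adjoint ip (T t) (Tstar t))
  (Hphic : continuous_on_nonneg phi) (Hphi0 : phi 0 = 1) (Hrho : 0 < rho)
  (Hphi : forall t, 0 <= t -> 0 < phi t <= exp (- rho * t))
  (HM : 1 <= M)
  (Hgrowth : forall t x, 0 <= t -> norm (T t x) <= M * exp (a * t) * norm x).

(** [RInt] is a total function, so the integral in [vdev] can be used only once existence is shown.
    As [t <= y], clamping both time arguments with [Rmax 0] changes nothing inside [(0, b)], and the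
    clamped integrand is continuous. *)
Lemma ex_RInt_burst (b c y t : R) (x g : V) : 0 < b -> t <= y ->
  ex_RInt (fun s => ip (T (b - s) (scal (c * phi (y + s - t)) x)) g) 0 b.
Proof.
  intros Hb Hy.
  apply ex_RInt_ext with
    (fun s => c * phi (Rmax 0 (y + s - t)) * ip (T (Rmax 0 (b - s)) x) g).
  - rewrite Rmin_left ?Rmax_right; try lra. intros s Hs.
    rewrite !(Rmax_right 0); try lra.
    rewrite (linear_scal _ (sg_bounded _ HT (b - s) ltac:(lra))) (ip_scal_l _ Hip). reflexivity.
  - apply (ex_RInt_continuous (V := R_CompleteNormedModule)). intros s _.
    apply (continuous_mult (K := R_AbsRing)).
    + apply (continuous_mult (K := R_AbsRing)); [apply continuous_const |].
      apply (continuous_comp (fun s => y + s - t) (fun r => phi (Rmax 0 r))).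
      * apply (ex_derive_continuous (V := R_NormedModule) (fun s => y + s - t)). auto_derive. trivial.
      * now apply continuous_on_nonneg_Rmax.
    + apply (continuous_comp (fun s => b - s) (fun r => ip (T (Rmax 0 r) x) g)).
      * apply (ex_derive_continuous (V := R_NormedModule) (fun s => b - s)). auto_derive. trivial.
      * apply (continuous_comp (fun r => T (Rmax 0 r) x) (fun z => ip z g)).
        -- apply orbit_continuous with M a; [exact HT | lra | exact Hgrowth].
        -- apply (linear_cont (U := V) (V := R_NormedModule) (fun z => ip z g)).
           now apply is_linear_ip.
Qed.

(* [E] is a bound on the norms of [T r] over one sampling interval: [M e^(ab)] when
   [0 <= a], but not when [a < 0]. *)
Lemma interval_jump_bound (N : nat) (tb : nat -> R) (h : nat -> V) (H : R) (eta : R -> V)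
    (K L D : R) (b x tau E W0 W1 : R) (j : nat) (g : V) :
  0 < D -> 0 < K -> 0 <= L ->
  (forall j, (1 <= j <= N)%nat -> norm (h j) <= H) ->
  (forall t, 0 <= t -> norm (eta t) <= K) ->
  (forall t s, 0 <= t -> 0 <= s -> norm (minus (eta (t + s)) (eta t)) <= L * s) ->
  (forall j, (1 <= j < N)%nat -> D + 4 * b <= tb (j + 1)%nat - tb j) ->
  (forall r, 0 <= r <= b -> M * exp (a * r) <= E) ->
  0 < b -> (1 <= j <= N)%nat -> 0 <= x -> tb j - 3 * b <= x -> x + b <= tb j ->
  0 <= tau -> tb j <= x + tau -> x + tau + b <= tb j + 4 * b ->
  is_RInt (fun s => ip (T (b - s) (source N tb h phi eta (x + s))) (scal (/ b) g)) 0 b W0 ->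
  is_RInt (fun s => ip (T (b - s) (source N tb h phi eta (x + tau + s))) (scal (/ b) g)) 0 b W1 ->
  Rabs (exp (rho * tau) * W1 - W0
    - RInt (fun s => ip (T (b - s) (scal (exp (rho * tau) * phi (x + tau + s - tb j)) (h j)))
                       (scal (/ b) g)) 0 b)
  <= E * norm g * (H / (exp (rho * D) - 1) + exp (rho * tau) * L * tau
                   + (exp (rho * tau) - 1) * K).
Proof.
  intros HD HK HL Hh HetaK HetaL Hsep HE Hb Hj Hx Hx1 Hx2 Htau Hx3 Hx4 HW0 HW1.
  pose proof (RInt_correct (V := R_CompleteNormedModule) _ _ _
    (ex_RInt_burst b (exp (rho * tau)) (x + tau) (tb j) (h j) (scal (/ b) g) Hb Hx3)) as HP.
  set (P := RInt _ 0 b) in HP |- *.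
  pose proof (is_RInt_minus _ _ _ _ _ _
    (is_RInt_minus _ _ _ _ _ _ (is_RInt_scal _ _ _ (exp (rho * tau)) _ HW1) HW0) HP) as HJ.
  set (B := H / (exp (rho * D) - 1) + exp (rho * tau) * L * tau + (exp (rho * tau) - 1) * K).
  change (minus (minus (scal (exp (rho * tau)) W1) W0) P)
    with (exp (rho * tau) * W1 - W0 - P) in HJ.
  (* The factor [/ b] of the test vector cancels the length [b] of the interval. *)
  replace (E * norm g * B) with (b * (E * (/ b * norm g) * B)) by (field; lra).
  apply is_RInt_abs_le with (2 := HJ); [lra |]. intros s Hs.
  assert (Hbs : 0 <= b - s <= b) by lra.
  set (l := fun y => ip (T (b - s) y) (scal (/ b) g)).
  assert (Hl : is_linear (V := R_NormedModule) l).
  { apply (is_linear_comp (T (b - s)) (fun z => ip z (scal (/ b) g))).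
    - apply (sg_bounded _ HT). lra.
    - now apply is_linear_ip. }
  assert (HE0 : 0 <= E).
  { apply Rle_trans with (2 := HE _ Hbs). pose proof (exp_pos (a * (b - s))). nra. }
  assert (Hib : 0 < / b) by now apply Rinv_0_lt_compat.
  pose proof (norm_ge_0 g) as Hg.
  assert (Hbg : 0 <= / b * norm g) by nra.
  assert (HlC : forall y, Rabs (l y) <= E * (/ b * norm g) * norm y).
  { intros y. pose proof (norm_ge_0 y) as Hy.
    apply Rle_trans with (1 := cauchy_schwarz _ Hip _ _).
    replace (E * (/ b * norm g) * norm y) with (E * norm y * (/ b * norm g)) by ring.
    apply Rmult_le_compat; try apply norm_ge_0; [| exact (norm_scal_inv_le b g Hb)].
    apply Rle_trans with (1 := Hgrowth _ y (proj1 Hbs)).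
    apply Rmult_le_compat_r; auto. }
  (* Inside the interval [x + s < tb j <= x + s + tau], so the pointwise jump bound applies to the
     functional [l]. *)
  assert (Hloc : Rabs (exp (rho * tau) * l (source N tb h phi eta (x + s + tau))
      - l (source N tb h phi eta (x + s))
      - exp (rho * tau) * phi (x + s + tau - tb j) * l (h j)) <= E * (/ b * norm g) * B).
  { apply source_jump_bound with (b := b) (D := D); auto; try lra. nra. }
  replace (x + s + tau) with (x + tau + s) in Hloc by ring.
  match goal with |- Rabs ?e <= _ => replace e with
    (exp (rho * tau) * l (source N tb h phi eta (x + tau + s))
      - l (source N tb h phi eta (x + s))
      - exp (rho * tau) * phi (x + tau + s - tb j) * l (h j)); [exact Hloc |] end.
  change (exp (rho * tau) * l (source N tb h phi eta (x + tau + s))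
      - l (source N tb h phi eta (x + s))
      - exp (rho * tau) * phi (x + tau + s - tb j) * l (h j)
    = exp (rho * tau) * l (source N tb h phi eta (x + tau + s))
      - l (source N tb h phi eta (x + s))
      - l (scal (exp (rho * tau) * phi (x + tau + s - tb j)) (h j))).
  f_equal. symmetry. apply (linear_scal l Hl).
Qed.

(** The adjoint moves [Tstar b] onto [u (INR m * b)], so without noise [Fseq] is the increment of
    the mild solution paired with [scal (/ b) g]; each of the two measurements adds at most [sigma].
    The noise at [INR m * b] has a hypothesis of its own, since this time is 0 for [m = 0]. *)
Lemma Fseq_integral (u0 : V) (F u : R -> V) (nu : R -> V -> R) (sigma b : R) (g : V) (m : nat) :
  is_mild_solution T u0 F u ->
  (forall t f, 0 < t -> Rabs (nu t f) <= sigma) ->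
  (forall f, Rabs (nu (INR m * b) f) <= sigma) ->
  0 < b ->
  exists W, is_RInt (fun s => ip (T (b - s) (F (INR m * b + s))) (scal (/ b) g)) 0 b W
    /\ Rabs (Fseq (measurement ip u nu) Tstar b g m - W) <= 2 * sigma.
Proof.
  intros Hu Hnu Hnum Hb.
  assert (Hmb : 0 <= INR m * b) by (apply Rmult_le_pos; [apply pos_INR | lra]).
  exists (ip (minus (u (INR m * b + b)) (T b (u (INR m * b)))) (scal (/ b) g)). split.
  - apply (is_RInt_linear (U := V) (V := R_NormedModule) (fun z => ip z (scal (/ b) g))).
    + now apply is_linear_ip.
    + apply mild_solution_increment with u0; auto. lra.
  - unfold Fseq, measurement.
    replace (INR (m + 1) * b) with (INR m * b + b) by (rewrite plus_INR; simpl; ring).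
    rewrite (ip_minus_l _ Hip) !(ip_scal_r _ Hip) (Hadj b (Rlt_le _ _ Hb)).
    assert (Hpos : 0 < INR m * b + b) by lra.
    pose proof (Hnu _ (scal (/ b) g) Hpos) as H1.
    pose proof (Hnum (scal (/ b) (Tstar b g))) as H2.
    set (n1 := nu _ _) in H1. set (n2 := nu _ _) in H2.
    apply Rabs_le_between in H1. apply Rabs_le_between in H2. apply Rabs_le.
    change (nu (INR m * b + b) _) with n1. change (nu (INR m * b) _) with n2. lra.
Qed.

(** The integrand deviates through [minus (T (b - s) x) x], small by strong continuity, and through
    [c * phi y - 1], small because the weight and [phi] are close to 1. Keeping [norm g] as a factor
    makes the radius independent of [g]. *)
Lemma vdev_small (x : V) (delta : R) : 0 < delta ->
  exists b0, 0 < b0 /\ forall b t n k i g, 0 < b < b0 -> in_window b t n ->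
    k = 2%nat \/ k = 3%nat -> i = 2%nat \/ i = 3%nat ->
    vdev ip T phi rho b t n k i x g <= delta * norm g.
Proof.
  intros Hdelta. pose proof (norm_ge_0 x) as Hx.
  destruct (semigroup_right_modulus T HT x (delta / 4)) as [d1 [Hd1 Hsg]]; [lra |].
  (* The 6 is [2 * 3]: [c * phi y] will be within [3 * d2] of 1, and this part may take half of
     [delta]. *)
  set (d2 := delta / (6 * (norm x + 1))).
  assert (Hd2 : 0 < d2) by (unfold d2; apply Rdiv_lt_0_compat; lra).
  assert (Hd2x : 6 * d2 * norm x <= delta).
  { unfold d2. apply Rle_trans with (delta * (norm x / (norm x + 1))).
    - apply Req_le. field. lra.
    - assert (norm x / (norm x + 1) <= 1) by (apply (Rle_div_l (norm x) 1 (norm x + 1)); lra).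
      nra. }
  destruct (proj1 (filterlim_locally phi (phi 0)) (Hphic 0 (Rle_refl 0)) (mkposreal d2 Hd2))
    as [d3 Hd3].
  (* Below [d4] the weight [exp (3 * rho * b)] is at most [1 + Rmin d2 1], hence also at most 2. *)
  set (d4 := ln (1 + Rmin d2 1) / (3 * rho)).
  assert (Hmin : 0 < Rmin d2 1) by (apply Rmin_glb_lt; lra).
  assert (Hd4 : 0 < d4).
  { unfold d4. apply Rdiv_lt_0_compat; [| lra]. rewrite -ln_1. apply ln_increasing; lra. }
  (* [phi] is evaluated at arguments up to [3 * b], hence [d3 / 3]. *)
  exists (Rmin d1 (Rmin (d3 / 3) d4)). split.
  { pose proof (cond_pos d3). repeat apply Rmin_glb_lt; lra. }
  intros b t n k i g Hb Hw Hk Hi.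
  assert (Hbd1 : b < d1) by (apply Rlt_le_trans with (1 := proj2 Hb), Rmin_l).
  assert (Hbd3 : b < d3 / 3).
  { apply Rlt_le_trans with (1 := proj2 Hb), Rle_trans with (1 := Rmin_r _ _), Rmin_l. }
  assert (Hbd4 : b < d4).
  { apply Rlt_le_trans with (1 := proj2 Hb), Rle_trans with (1 := Rmin_r _ _), Rmin_r. }
  pose proof (norm_ge_0 g) as Hg.
  set (c := exp (INR k * rho * b)).
  assert (Hc : 1 <= c <= 1 + Rmin d2 1).
  { assert (Hk3 : 0 <= INR k <= 3) by (destruct Hk as [-> | ->]; simpl; lra).
    assert (Hrb : 0 < rho * b) by nra. split.
    - unfold c. rewrite -exp_0. apply exp_le_exp. nra.
    - rewrite -(exp_ln (1 + Rmin d2 1)); [| lra]. apply exp_le_exp.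
      apply Rle_trans with (3 * rho * d4); [nra |].
      apply Req_le. unfold d4. field. lra. }
  pose proof (Rmin_l d2 1) as Hm1. pose proof (Rmin_r d2 1) as Hm2.
  assert (Hwi : forall s, 0 < s < b -> 0 <= INR (n + i) * b + s - t <= 3 * b).
  { intros s Hs. unfold in_window in Hw. rewrite !plus_INR in Hw |- *. simpl in Hw.
    destruct Hi as [-> | ->]; simpl; lra. }
  assert (Hti : t <= INR (n + i) * b).
  { unfold in_window in Hw. rewrite !plus_INR in Hw |- *. simpl in Hw.
    destruct Hi as [-> | ->]; simpl; lra. }
  unfold vdev. fold c.
  pose proof (RInt_correct (V := R_CompleteNormedModule) _ _ _
    (ex_RInt_burst b c (INR (n + i) * b) t x (scal (/ b) g) (proj1 Hb) Hti)) as HP.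
  set (P := RInt _ 0 b) in HP |- *.
  pose proof (is_RInt_minus _ _ _ _ _ _ HP (is_RInt_const 0 b (ip x (scal (/ b) g)))) as HJ.
  assert (EJ : minus P (scal (b - 0) (ip x (scal (/ b) g))) = P - ip x g).
  { change (P - (b - 0) * ip x (scal (/ b) g) = P - ip x g).
    rewrite (ip_scal_r _ Hip). field. lra. }
  rewrite EJ in HJ.
  replace (delta * norm g) with (b * (delta * (/ b * norm g))) by (field; lra).
  apply is_RInt_abs_le with (2 := HJ); [lra |]. intros s Hs.
  pose proof (Hwi s Hs) as Hy. set (y := INR (n + i) * b + s - t) in Hy |- *.
  assert (Hbs : 0 <= b - s < d1) by lra.
  assert (Hphiy : Rabs (phi y - 1) < d2).
  { rewrite -Hphi0. apply (Hd3 y); [| lra]. change (Rabs (y - 0) < d3).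
    rewrite Rabs_pos_eq; lra. }
  assert (Hphi1 : 0 < phi y <= 1).
  { pose proof (Hphi y (proj1 Hy)) as [P0 P1]. split; [exact P0 |].
    apply Rle_trans with (1 := P1). rewrite -exp_0. apply exp_le_exp. nra. }
  assert (Egap : minus (ip (T (b - s) (scal (c * phi y) x)) (scal (/ b) g)) (ip x (scal (/ b) g))
    = c * phi y * ip (minus (T (b - s) x) x) (scal (/ b) g)
      + (c * phi y - 1) * ip x (scal (/ b) g)).
  { rewrite (linear_scal _ (sg_bounded _ HT (b - s) (proj1 Hbs))) (ip_scal_l _ Hip)
      (ip_minus_l _ Hip).
    change (c * phi y * ip (T (b - s) x) (scal (/ b) g) - ip x (scal (/ b) g)
      = c * phi y * (ip (T (b - s) x) (scal (/ b) g) - ip x (scal (/ b) g))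
        + (c * phi y - 1) * ip x (scal (/ b) g)).
    ring. }
  rewrite Egap.
  assert (Hib : 0 < / b) by (apply Rinv_0_lt_compat; lra).
  set (G := / b * norm g).
  assert (HG : 0 <= G) by (unfold G; nra).
  assert (H1 : Rabs (ip (minus (T (b - s) x) x) (scal (/ b) g)) <= delta / 4 * G).
  { apply Rle_trans with (1 := cauchy_schwarz _ Hip _ _).
    apply Rmult_le_compat; try apply norm_ge_0.
    - left. now apply Hsg.
    - exact (norm_scal_inv_le b g (proj1 Hb)). }
  assert (H2 : Rabs (ip x (scal (/ b) g)) <= norm x * G).
  { apply Rle_trans with (1 := cauchy_schwarz _ Hip _ _).
    apply Rmult_le_compat_l; [exact Hx |]. exact (norm_scal_inv_le b g (proj1 Hb)). }
  assert (H3 : Rabs (c * phi y - 1) <= 3 * d2).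
  { replace (c * phi y - 1) with (c * (phi y - 1) + (c - 1)) by ring.
    apply Rle_trans with (1 := Rabs_triang _ _). rewrite Rabs_mult !(Rabs_pos_eq c); [| lra].
    rewrite (Rabs_pos_eq (c - 1)); [| lra]. pose proof (Rabs_pos (phi y - 1)). nra. }
  assert (H4 : Rabs (c * phi y) <= 2) by (rewrite Rabs_pos_eq; nra).
  apply Rle_trans with (1 := Rabs_triang _ _).
  rewrite (Rabs_mult (c * phi y)) (Rabs_mult (c * phi y - 1)).
  assert (H5 : Rabs (c * phi y) * Rabs (ip (minus (T (b - s) x) x) (scal (/ b) g))
    <= 2 * (delta / 4 * G)) by (apply Rmult_le_compat; auto; apply Rabs_pos).
  assert (H6 : Rabs (c * phi y - 1) * Rabs (ip x (scal (/ b) g)) <= 3 * d2 * (norm x * G))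
    by (apply Rmult_le_compat; auto; apply Rabs_pos).
  pose proof (Rmult_le_compat_r G _ _ HG Hd2x). unfold G in *.
  apply Rle_trans with (1 := Rplus_le_compat _ _ _ _ H5 H6). lra.
Qed.

(** * Error of an output, for a detected or a missed burst *)

Section Reconstruction.

Context (N : nat) (tb : nat -> R) (h : nat -> V) (H : R) (eta : R -> V) (K L D : R)
  (u0 : V) (u : R -> V) (nu : R -> V -> R) (sigma b E : R) (j n : nat) (g : V).
Hypotheses (HD : 0 < D) (HK : 0 < K) (HL : 0 <= L)
  (Hh : forall j, (1 <= j <= N)%nat -> norm (h j) <= H)
  (HetaK : forall t, 0 <= t -> norm (eta t) <= K)
  (HetaL : forall t s, 0 <= t -> 0 <= s -> norm (minus (eta (t + s)) (eta t)) <= L * s)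
  (Hu : is_mild_solution T u0 (source N tb h phi eta) u)
  (Hnu : forall t f, 0 < t -> Rabs (nu t f) <= sigma)
  (Hsep : forall j, (1 <= j < N)%nat -> D + 4 * b <= tb (j + 1)%nat - tb j)
  (HE : forall r, 0 <= r <= b -> M * exp (a * r) <= E)
  (Hb : 0 < b) (Hj : (1 <= j <= N)%nat) (Hw : in_window b (tb j) n)
  (Hn : (2 <= n)%nat \/ forall f, Rabs (nu 0 f) <= sigma).

Local Notation F := (Fseq (measurement ip u nu) Tstar b g).
Local Notation v k i := (vdev ip T phi rho b (tb j) n k i (h j) g).

(** The bounds on [m] and [i] put the sampling interval of [m] before the burst, starting at most
    [3 * b] earlier, and that of [m + k] after it, ending at most [4 * b] later. [v k i] is the cost
    of replacing the integral of the burst itself by [ip (h j) g]. *)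
Lemma sample_jump_bound (m k i : nat) :
  (m + k = n + i)%nat -> (n <= m + 1)%nat -> (m <= n)%nat -> (2 <= i <= 4)%nat ->
  Rabs (exp (INR k * rho * b) * F (m + k)%nat - F m - ip (h j) g)
  <= E * norm g * (H / (exp (rho * D) - 1) + exp (INR k * rho * b) * L * (INR k * b)
                   + (exp (INR k * rho * b) - 1) * K)
     + 4 * exp (INR k * rho * b) * sigma + v k i.
Proof.
  intros Hmk Hnm Hmn Hi.
  (* Sample 0 enters only if [n <= 1]; the noise at time 0 is then controlled by the second
     alternative of [Hn]. *)
  assert (Hnum : forall f, Rabs (nu (INR m * b) f) <= sigma).
  { intros f. destruct m as [| m'].
    - simpl. rewrite Rmult_0_l. destruct Hn as [Hn2 | Hn0]; [lia | apply Hn0].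
    - apply Hnu. apply Rmult_lt_0_compat; [apply lt_0_INR; lia | exact Hb]. }
  assert (Hnumk : forall f, Rabs (nu (INR (m + k) * b) f) <= sigma).
  { intros f. apply Hnu. apply Rmult_lt_0_compat; [apply lt_0_INR; lia | exact Hb]. }
  destruct (Fseq_integral u0 _ u nu sigma b g m Hu Hnu Hnum Hb) as [W0 [HW0 HF0]].
  destruct (Fseq_integral u0 _ u nu sigma b g (m + k) Hu Hnu Hnumk Hb) as [W1 [HW1 HF1]].
  assert (E1 : rho * (INR k * b) = INR k * rho * b) by ring.
  assert (E2 : INR m * b + INR k * b = INR (n + i) * b) by (rewrite -Hmk plus_INR; ring).
  rewrite {1}Hmk -E2 in HW1.
  pose proof Hw as Hwn. unfold in_window in Hwn.
  assert (Hm0 : 0 <= INR m * b) by (apply Rmult_le_pos; [apply pos_INR | lra]).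
  assert (Hk0 : 0 <= INR k * b) by (apply Rmult_le_pos; [apply pos_INR | lra]).
  assert (Hmn' : INR m <= INR n) by (apply le_INR; lia).
  assert (Hnm' : INR n <= INR m + 1) by (rewrite -S_INR; apply le_INR; lia).
  assert (Hi' : 2 <= INR i <= 4).
  { pose proof (le_INR 2 i (proj1 Hi)). pose proof (le_INR i 4 (proj2 Hi)). simpl in *. lra. }
  rewrite !plus_INR in Hwn E2. simpl in Hwn.
  assert (J := interval_jump_bound N tb h H eta K L D b (INR m * b) (INR k * b) E W0 W1 j g
    HD HK HL Hh HetaK HetaL Hsep HE Hb Hj Hm0 ltac:(nra) ltac:(nra) Hk0 ltac:(nra) ltac:(nra)
    HW0 HW1).
  rewrite E1 E2 -plus_INR in J.
  unfold vdev. set (P := RInt _ 0 b) in J |- *.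
  set (e := exp (INR k * rho * b)) in J |- *.
  assert (He : 1 <= e).
  { unfold e. rewrite -exp_0. apply exp_le_exp. rewrite -E1. nra. }
  set (B := E * norm g * _) in J |- *.
  assert (Hsig : 0 <= sigma) by (apply Rle_trans with (2 := Hnum g); apply Rabs_pos).
  replace (e * F (m + k)%nat - F m - ip (h j) g)
    with ((e * W1 - W0 - P) + (e * (F (m + k)%nat - W1) - (F m - W0)) + (P - ip (h j) g)) by ring.
  (* Each sample carries noise at most [2 * sigma], and [1 <= e] gives
     [2 * (e + 1) * sigma <= 4 * e * sigma]. *)
  assert (Hnoise : Rabs (e * (F (m + k)%nat - W1) - (F m - W0)) <= 4 * e * sigma).
  { apply Rabs_le_between in HF0. apply Rabs_le_between in HF1. apply Rabs_le. nra. }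
  pose proof (Rabs_triang ((e * W1 - W0 - P) + (e * (F (m + k)%nat - W1) - (F m - W0)))
    (P - ip (h j) g)).
  pose proof (Rabs_triang (e * W1 - W0 - P) (e * (F (m + k)%nat - W1) - (F m - W0))).
  lra.
Qed.

Lemma burst_output_error (Q Tmax : R) (ot : option R) (f : R) : 0 <= Q ->
  burst_output rho b Q D Tmax F n ot f ->
  Rabs (f - ip (h j) g)
  <= E * norm g * (H / (exp (rho * D) - 1) + exp (3 * rho * b) * L * (3 * b)
                   + (exp (3 * rho * b) - 1) * K)
     + 4 * exp (3 * rho * b) * sigma + 2 * exp (rho * b) * Q
     + Rmax (v 3%nat 2%nat) (Rmax (v 3%nat 3%nat) (v 2%nat 2%nat)).
Proof.
  intros HQ Hout.
  assert (He1 : 1 <= exp (rho * b)) by (rewrite -exp_0; apply exp_le_exp; nra).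
  set (vm := Rmax _ _).
  assert (Hv32 : v 3%nat 2%nat <= vm) by apply Rmax_l.
  assert (Hv33 : v 3%nat 3%nat <= vm) by (apply Rle_trans with (2 := Rmax_r _ _); apply Rmax_l).
  assert (Hv22 : v 2%nat 2%nat <= vm) by (apply Rle_trans with (2 := Rmax_r _ _); apply Rmax_r).
  assert (I3 : INR 3 = 3) by (simpl; ring). assert (I2 : INR 2 = 2) by (simpl; ring).
  assert (HeQ : 0 <= exp (rho * b) * Q) by nra.
  destruct (burst_output_cases _ _ _ _ _ _ _ _ _ Hout)
    as [[k [Hk1 [[-> | ->] [_ ->]]]] | [Hnd [_ ->]]].
  (* Trigger at [n]: samples [n - 1] and [n + 2]. *)
  - pose proof (sample_jump_bound (n - 1) 3 2 ltac:(lia) ltac:(lia) ltac:(lia) ltac:(lia)) as J.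
    rewrite I3 in J. replace (n - 1 + 3)%nat with (n + 2)%nat in J by lia. lra.
  (* Trigger at [n + 1]: samples [n] and [n + 3]. *)
  - pose proof (sample_jump_bound n 3 3 ltac:(lia) ltac:(lia) ltac:(lia) ltac:(lia)) as J.
    rewrite I3 in J. replace (n + 1 + 2)%nat with (n + 3)%nat by lia.
    replace (n + 1 - 1)%nat with n by lia. lra.
  (* No detection: a two-step jump from [n] to [n + 2], whose bound is then enlarged to the
     three-step one. *)
  - pose proof (sample_jump_bound n 2 2 ltac:(lia) ltac:(lia) ltac:(lia) ltac:(lia)) as J.
    rewrite I2 in J.
    assert (D1 : Rabs (Dseq rho b F n) <= Q).
    { apply Rnot_lt_le. intros HQn. apply Hnd. now left. }
    assert (D2 : Rabs (Dseq rho b F (n + 1)) <= Q).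
    { apply Rnot_lt_le. intros HQn. apply Hnd. now right. }
    (* The terms in [F (n + 1)] cancel. The two subthreshold values then contribute at most
       [(exp (rho * b) + 1) * Q], which is within [2 * exp (rho * b) * Q]. *)
    assert (Hsum : exp (2 * rho * b) * F (n + 2)%nat - F n
      = exp (rho * b) * Dseq rho b F (n + 1) + Dseq rho b F n).
    { unfold Dseq. replace (n + 1 + 1)%nat with (n + 2)%nat by lia.
      replace (exp (2 * rho * b)) with (exp (rho * b) * exp (rho * b))
        by (rewrite -exp_plus; f_equal; ring). ring. }
    assert (Hd : Rabs (exp (2 * rho * b) * F (n + 2)%nat - F n) <= 2 * exp (rho * b) * Q).
    { rewrite Hsum. apply Rabs_le_between in D1. apply Rabs_le_between in D2.
      apply Rabs_le. nra. }
    assert (He2 : 1 <= exp (2 * rho * b)) by (rewrite -exp_0; apply exp_le_exp; nra).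
    assert (He23 : exp (2 * rho * b) <= exp (3 * rho * b)) by (apply exp_le_exp; nra).
    assert (HEg : 0 <= E * norm g).
    { apply Rmult_le_pos; [| apply norm_ge_0].
      apply Rle_trans with (2 := HE 0 ltac:(lra)). pose proof (exp_pos (a * 0)). nra. }
    assert (Hsig : 0 <= sigma) by (apply Rle_trans with (2 := Hnu 1 g Rlt_0_1); apply Rabs_pos).
    assert (Hbg : E * norm g * (H / (exp (rho * D) - 1) + exp (2 * rho * b) * L * (2 * b)
                     + (exp (2 * rho * b) - 1) * K)
      <= E * norm g * (H / (exp (rho * D) - 1) + exp (3 * rho * b) * L * (3 * b)
                     + (exp (3 * rho * b) - 1) * K)).
    { apply Rmult_le_compat_l; [exact HEg |].
      assert (exp (2 * rho * b) * L * (2 * b) <= exp (3 * rho * b) * L * (3 * b)).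
      { apply Rmult_le_compat; nra. }
      nra. }
    assert (Hs : 4 * exp (2 * rho * b) * sigma <= 4 * exp (3 * rho * b) * sigma) by nra.
    replace (0 - ip (h j) g) with
      ((exp (2 * rho * b) * F (n + 2)%nat - F n - ip (h j) g)
       - (exp (2 * rho * b) * F (n + 2)%nat - F n)) by ring.
    apply Rle_trans with (1 := Rabs_triang _ _). rewrite Rabs_Ropp. lra.
Qed.

End Reconstruction.

End Measurements.

(** * Uniform choice of a small sampling step *)

Lemma finite_common_radius (N : nat) (P : nat -> R -> Prop) :
  (forall j, (1 <= j <= N)%nat -> exists b0, 0 < b0 /\ forall b, 0 < b < b0 -> P j b) ->
  exists b0, 0 < b0 /\ forall j b, (1 <= j <= N)%nat -> 0 < b < b0 -> P j b.
Proof.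
  induction N as [| N IH]; intros HP.
  - exists 1. split; [lra | lia].
  - destruct IH as [b1 [Hb1 H1]]; [intros j Hj; apply HP; lia |].
    destruct (HP (S N)) as [b2 [Hb2 H2]]; [lia |].
    exists (Rmin b1 b2). split; [now apply Rmin_glb_lt |]. intros j b Hj Hb.
    pose proof (Rmin_l b1 b2). pose proof (Rmin_r b1 b2).
    destruct (Nat.eq_dec j (S N)) as [-> | Hne]; [apply H2; lra | apply H1; [lia | lra]].
Qed.

Lemma eps_ge_0 (M a b H Rg rho D : R) : 0 < rho -> 0 < D -> 0 <= M -> 0 <= H -> 0 <= Rg ->
  0 <= eps M a b H Rg rho D.
Proof.
  intros Hrho HD HM HH HRg. unfold eps.
  assert (1 < exp (rho * D)) by (rewrite -exp_0; apply exp_increasing; nra).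
  repeat apply Rmult_le_pos; auto; try lra.
  - left. apply Rinv_0_lt_compat. lra.
  - left. apply exp_pos.
Qed.

Lemma Qthr_ge_0 (M a b rho L K sigma ng : R) : 0 < rho -> 0 < b -> 0 <= M -> 0 <= L -> 0 <= K ->
  0 <= sigma -> 0 <= ng -> 0 <= Qthr M a b rho L K sigma ng.
Proof.
  intros Hrho Hb HM HL HK Hsigma Hng. unfold Qthr.
  assert (1 < exp (rho * b)) by (rewrite -exp_0; apply exp_increasing; nra).
  repeat apply Rplus_le_le_0_compat; repeat apply Rmult_le_pos; auto; try lra;
    left; apply exp_pos.
Qed.

Lemma Qthr_le (M a b rho L K sigma ng ng' : R) : 0 < rho -> 0 < b -> 0 <= M -> 0 <= L -> 0 <= K ->
  ng <= ng' -> Qthr M a b rho L K sigma ng <= Qthr M a b rho L K sigma ng'.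
Proof.
  intros Hrho Hb HM HL HK Hng. unfold Qthr.
  assert (1 < exp (rho * b)) by (rewrite -exp_0; apply exp_increasing; nra).
  repeat apply Rplus_le_compat; try apply Rle_refl.
  - apply Rmult_le_compat_r; [lra |]. apply Rmult_le_compat_l; [| exact Hng].
    repeat apply Rmult_le_pos; auto. left. apply exp_pos.
  - apply Rmult_le_compat_l; [| exact Hng].
    repeat apply Rmult_le_pos; auto; [left; apply exp_pos | lra].
Qed.

(* At [b = 0] the left side is [12 sigma + 5/2 eps + delta Rg]. *)
Lemma error_bound_near_0 (M a a' rho L K sigma H Rg D delta : R) :
  delta * Rg < sigma + 3 * (M * H * Rg / (exp (rho * D) - 1)) ->
  exists b0, 0 < b0 /\ forall b, 0 < b < b0 ->
    M * exp (a' * b) * Rg * (H / (exp (rho * D) - 1) + exp (3 * rho * b) * L * (3 * b)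
                             + (exp (3 * rho * b) - 1) * K)
    + 4 * exp (3 * rho * b) * sigma
    + 2 * exp (rho * b) * (Qthr M a b rho L K sigma Rg + eps M a b H Rg rho D) + delta * Rg
    <= 13 * sigma + 4 * eps M a b H Rg rho D.
Proof.
  unfold Qthr, eps, Rdiv. set (q := / (exp (rho * D) - 1)). intros Hdelta.
  set (lhs := fun b => M * exp (a' * b) * Rg * (H * q + exp (3 * rho * b) * L * (3 * b)
      + (exp (3 * rho * b) - 1) * K) + 4 * exp (3 * rho * b) * sigma
      + 2 * exp (rho * b) * (exp ((rho + a) * b) * M * L * Rg * b
        + exp (a * b) * (exp (rho * b) - 1) * M * K * Rg + 4 * exp (rho * b) * sigma
        + 2 * q * M * exp (a * b) * H * Rg) + delta * Rg).
  set (gap := fun b => 13 * sigma + 4 * (2 * q * M * exp (a * b) * H * Rg) - lhs b).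
  (* [Hdelta] makes the gap positive at [b = 0], and continuity keeps it positive nearby. *)
  assert (Hc : continuous gap 0).
  { apply (ex_derive_continuous (V := R_NormedModule) gap). unfold gap, lhs. auto_derive. trivial. }
  assert (Hgap0 : 0 < gap 0) by (unfold gap, lhs; rewrite !Rmult_0_r !exp_0; lra).
  destruct (Hc (fun y => 0 < y) (open_gt 0 (gap 0) Hgap0)) as [d Hd].
  exists d. split; [apply cond_pos |]. intros b Hb.
  assert (Hgap : 0 < gap b).
  { apply Hd. change (Rabs (b - 0) < d). rewrite Rabs_pos_eq; lra. }
  unfold gap, lhs in Hgap. lra.
Qed.

(** * Time and value errors, the limit of the deviations, and the bound for small steps *)

Theorem theorem3p5 :
  forall (V : CompleteNormedModule R_AbsRing) (ip : V -> V -> R)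
    (T Tstar : R -> V -> V) (dom : V -> Prop) (A : V -> V) (u0 : V)
    (phi : R -> R) (rho : R)
    (N : nat) (tb : nat -> R) (h : nat -> V) (H : R)
    (eta : R -> V) (K L : R) (u : R -> V)
    (nu : R -> V -> R) (sigma : R)
    (Gt : V -> Prop) (Rg D M a : R),
  is_inner_product ip ->
  is_C0_semigroup T ->
  is_generator T dom A ->
  (forall t, 0 <= t -> is_adjoint ip (T t) (Tstar t)) ->
  continuous_on_nonneg phi ->
  phi 0 = 1 ->
  0 < rho ->
  (forall t, 0 <= t -> 0 < phi t <= exp (- rho * t)) ->
  0 < tb 1%nat ->
  (forall j, (1 <= j < N)%nat -> tb j < tb (j + 1)%nat) ->
  (forall j, (1 <= j <= N)%nat -> norm (h j) <= H) ->
  0 < K ->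
  0 <= L ->
  (forall t, 0 <= t -> norm (eta t) <= K) ->
  (forall t s, 0 <= t -> 0 <= s -> norm (minus (eta (t + s)) (eta t)) <= L * s) ->
  is_mild_solution T u0 (source N tb h phi eta) u ->
  (forall t f, 0 < t -> Rabs (nu t f) <= sigma) ->
  is_countable Gt ->
  is_lub (fun r => exists g, Gt g /\ r = norm g) Rg ->
  0 < D ->
  1 <= M ->
  (forall t x, 0 <= t -> norm (T t x) <= M * exp (a * t) * norm x) ->
  let separated beta :=
    forall j, (1 <= j < N)%nat -> D + 4 * beta <= tb (j + 1)%nat - tb j in
  let F beta g := Fseq (measurement ip u nu) Tstar beta g in
  let e beta := eps M a beta H Rg rho D in
  let Q1 beta g := Qthr M a beta rho L K sigma (norm g) + e beta in
  let v beta n k i j g := vdev ip T phi rho beta (tb j) n k i (h j) g in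
  (forall beta Tmax, 0 < beta -> separated beta ->
   forall g j n ot f, Gt g -> (1 <= j <= N)%nat -> in_window beta (tb j) n ->
   burst_output rho beta (Q1 beta g) D Tmax (F beta g) n ot f ->
   (forall t, ot = Some t -> Rabs (t - tb j) <= beta) /\
   (0 <= a ->
    (2 <= n)%nat \/ (forall x, Rabs (nu 0 x) <= sigma) ->
    Rabs (f - ip (h j) g)
      <= e beta
         + 3 * exp ((3 * rho + a) * beta) * M * L * norm g * beta
         + exp (a * beta) * (exp (3 * rho * beta) - 1) * M * K * norm g
         + 4 * exp (3 * rho * beta) * sigma
         + 2 * exp (rho * beta) * Q1 beta g
         + Rmax (v beta n 3%nat 2%nat j g)
                (Rmax (v beta n 3%nat 3%nat j g) (v beta n 2%nat 2%nat j g))))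
  /\
  (forall g j k i, Gt g -> (1 <= j <= N)%nat ->
   k = 2%nat \/ k = 3%nat -> i = 2%nat \/ i = 3%nat ->
   forall delta, 0 < delta ->
   exists beta0, 0 < beta0 /\
   forall beta n, 0 < beta < beta0 -> in_window beta (tb j) n ->
   v beta n k i j g < delta)
  /\
  (exists beta0, 0 < beta0 /\
   forall beta Tmax, 0 < beta < beta0 -> separated beta ->
   ~ (sigma = 0 /\ e beta = 0) ->
   forall g j n ot f, Gt g -> (1 <= j <= N)%nat -> in_window beta (tb j) n ->
   burst_output rho beta (Q1 beta g) D Tmax (F beta g) n ot f ->
   Rabs (f - ip (h j) g) <= 13 * sigma + 4 * e beta).
Proof.
  intros V ip T Tstar dom A u0 phi rho N tb h H eta K L u nu sigma Gt Rg D M a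
    Hip HT _ Hadj Hphic Hphi0 Hrho Hphi Htb1 Htb Hh HK HL HetaK HetaL Hu Hnu _ HRg HD HM Hgrowth
    separated F e Q1 v.
  assert (Hsig : 0 <= sigma).
  { apply Rle_trans with (2 := Hnu 1 zero Rlt_0_1). apply Rabs_pos. }
  assert (HngR : forall g, Gt g -> norm g <= Rg).
  { intros g Hg. apply (proj1 HRg). now exists g. }
  assert (HH : forall j, (1 <= j <= N)%nat -> 0 <= H).
  { intros j Hj. apply Rle_trans with (2 := Hh j Hj). apply norm_ge_0. }
  assert (HD1 : 1 < exp (rho * D)) by (rewrite -exp_0; apply exp_increasing; nra).
  set (q := / (exp (rho * D) - 1)).
  assert (Hq : 0 < q) by (apply Rinv_0_lt_compat; lra).
  assert (Hsmall : forall j delta, 0 < delta ->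
    exists b0, 0 < b0 /\ forall b t n k i g, 0 < b < b0 -> in_window b t n ->
      k = 2%nat \/ k = 3%nat -> i = 2%nat \/ i = 3%nat ->
      vdev ip T phi rho b t n k i (h j) g <= delta * norm g).
  { intros j delta Hdelta.
    exact (vdev_small ip T phi rho M a Hip HT Hphic Hphi0 Hrho Hphi HM Hgrowth (h j) delta Hdelta). }
  split; [| split].
  - intros b Tmax Hb Hsep g j n ot f Hg Hj Hw Hout. split.
    { intros t Et.
      destruct (burst_output_cases _ _ _ _ _ _ _ _ _ Hout)
        as [[k [_ [Hk [Eot _]]]] | [_ [Eot _]]]; rewrite Eot in Et; inversion Et.
      now apply window_output_time with n. }
    intros Ha Hn.
    pose proof (norm_ge_0 g) as Hng. pose proof (HngR g Hg) as HgR. pose proof (HH j Hj) as HH0.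
    (* For [0 <= a] the growth bound increases along the sampling interval, so its value at [b]
       serves as [E]. *)
    assert (HE : forall r, 0 <= r <= b -> M * exp (a * r) <= M * exp (a * b)).
    { intros r Hr. apply Rmult_le_compat_l; [lra |]. apply exp_le_exp. nra. }
    assert (HQ1 : 0 <= Q1 b g).
    { apply Rplus_le_le_0_compat; [apply Qthr_ge_0 | apply eps_ge_0]; lra. }
    pose proof (burst_output_error ip T Tstar phi rho M a Hip HT Hadj Hphic Hrho Hphi HM Hgrowth
      N tb h H eta K L D u0 u nu sigma b (M * exp (a * b)) j n g HD HK HL Hh HetaK HetaL Hu Hnu
      Hsep HE Hb Hj Hw Hn (Q1 b g) Tmax ot f HQ1 Hout) as Herr.
    unfold v. set (vm := Rmax _ _) in Herr |- *.
    apply Rle_trans with (1 := Herr).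
    replace (exp ((3 * rho + a) * b)) with (exp (3 * rho * b) * exp (a * b))
      by (rewrite -exp_plus; f_equal; ring).
    (* The old bursts use only half of [e b], after [norm g] is replaced by [Rg]. *)
    assert (Heps : M * exp (a * b) * norm g * (H * q) <= e b).
    { unfold e, eps, Rdiv. fold q.
      replace (2 * q * M * exp (a * b) * H * Rg) with (2 * (M * exp (a * b) * (H * q) * Rg)) by ring.
      assert (Hc : 0 <= M * exp (a * b) * (H * q)).
      { pose proof (exp_pos (a * b)). repeat apply Rmult_le_pos; lra. }
      nra. }
    unfold Rdiv. fold q. lra.
  - intros g j k i Hg Hj Hk Hi delta Hdelta. pose proof (norm_ge_0 g) as Hng.
    assert (Hd : 0 < delta / (norm g + 1)) by (apply Rdiv_lt_0_compat; lra).
    destruct (Hsmall j _ Hd) as [b0 [Hb0 Hv]].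
    exists b0. split; [exact Hb0 |]. intros b n Hb Hw.
    apply Rle_lt_trans with (1 := Hv b (tb j) n k i g Hb Hw Hk Hi).
    assert (delta / (norm g + 1) * (norm g + 1) = delta) by (field; lra). lra.
  (* [0 <= H] is read off from an actual burst, so [N = 0] is settled first. *)
  - destruct (Nat.eq_dec N 0) as [HN0 | HN].
    { exists 1. split; [lra |]. intros. lia. }
    assert (HH0 : 0 <= H) by (apply (HH 1%nat); lia).
    destruct (Rle_dec 0 Rg) as [HRg0 | HRg0]; cycle 1.
    { exists 1. split; [lra |]. intros b Tmax _ _ _ g j n ot f Hg.
      pose proof (norm_ge_0 g). pose proof (HngR g Hg). lra. }
    assert (HX : 0 <= M * H * Rg * q) by (repeat apply Rmult_le_pos; lra).
    (* This quantity is free of [beta], so the degenerate case is decided before the radius is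
       chosen; if it is 0, then [sigma] and every [e beta] vanish. *)
    destruct (Rle_lt_dec (sigma + 3 * (M * H * Rg * q)) 0) as [Hzero | Hpos].
    { exists 1. split; [lra |]. intros b Tmax _ _ Hne. exfalso. apply Hne. split; [lra |].
      unfold e, eps, Rdiv. fold q.
      replace (2 * q * M * exp (a * b) * H * Rg) with (2 * exp (a * b) * (M * H * Rg * q)) by ring.
      replace (M * H * Rg * q) with 0 by lra. ring. }
    (* Dividing by [Rg + 1] makes [delta * Rg] strictly smaller than the slack available at step
       0. *)
    set (delta := (sigma + 3 * (M * H * Rg * q)) / (Rg + 1)).
    assert (Hdelta : 0 < delta) by (apply Rdiv_lt_0_compat; lra).
    assert (HdR : delta * Rg < sigma + 3 * (M * H * Rg / (exp (rho * D) - 1))).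
    { unfold Rdiv at 1. fold q.
      replace (sigma + 3 * (M * H * Rg * q)) with (delta * (Rg + 1)) by (unfold delta; field; lra).
      lra. }
    (* For [a < 0] the growth bound is largest at the start of the sampling interval; the rate
       [Rmax a 0] covers both signs and leaves the value at step 0 unchanged. *)
    destruct (error_bound_near_0 M a (Rmax a 0) rho L K sigma H Rg D delta HdR)
      as [b1 [Hb1 Hbound]].
    destruct (finite_common_radius N (fun j b => forall n k i g, in_window b (tb j) n ->
        k = 2%nat \/ k = 3%nat -> i = 2%nat \/ i = 3%nat ->
        vdev ip T phi rho b (tb j) n k i (h j) g <= delta * norm g)) as [b2 [Hb2 Hv]].
    { intros j _. destruct (Hsmall j delta Hdelta) as [b0 [Hb0 Hv]].
      exists b0. split; [exact Hb0 |]. intros b Hb n k i g. now apply Hv. }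
    (* With [4 * b < tb 1], every burst window has [2 <= n], so no measurement at time 0 is
       involved. *)
    exists (Rmin (Rmin b1 b2) (tb 1%nat / 4)). split.
    { repeat apply Rmin_glb_lt; lra. }
    intros b Tmax Hb Hsep _ g j n ot f Hg Hj Hw Hout.
    assert (Hbb : b < b1 /\ b < b2 /\ b < tb 1%nat / 4).
    { pose proof (Rmin_l (Rmin b1 b2) (tb 1%nat / 4)). pose proof (Rmin_r (Rmin b1 b2) (tb 1%nat / 4)).
      pose proof (Rmin_l b1 b2). pose proof (Rmin_r b1 b2). lra. }
    assert (Hb0 : 0 < b) by lra.
    assert (Hn : (2 <= n)%nat).
    { assert (Htbj : INR (j - 1) * 0 <= tb j - tb 1%nat).
      { apply (separated_distance N); try lia. intros i Hi. specialize (Htb i Hi). lra. }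
      apply INR_le. unfold in_window in Hw. rewrite !plus_INR in Hw. simpl in Hw |- *. nra. }
    pose proof (norm_ge_0 g) as Hng. pose proof (HngR g Hg) as HgR.
    assert (HE : forall r, 0 <= r <= b -> M * exp (a * r) <= M * exp (Rmax a 0 * b)).
    { intros r Hr. apply Rmult_le_compat_l; [lra |]. apply exp_le_exp.
      pose proof (Rmax_l a 0). pose proof (Rmax_r a 0).
      apply Rle_trans with (Rmax a 0 * r); [apply Rmult_le_compat_r | apply Rmult_le_compat_l]; lra. }
    assert (HQ1 : 0 <= Q1 b g).
    { apply Rplus_le_le_0_compat; [apply Qthr_ge_0 | apply eps_ge_0]; lra. }
    pose proof (burst_output_error ip T Tstar phi rho M a Hip HT Hadj Hphic Hrho Hphi HM Hgrowth
      N tb h H eta K L D u0 u nu sigma b (M * exp (Rmax a 0 * b)) j n g HD HK HL Hh HetaK HetaL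
      Hu Hnu Hsep HE Hb0 Hj Hw (or_introl Hn) (Q1 b g) Tmax ot f HQ1 Hout) as Herr.
    apply Rle_trans with (1 := Herr).
    (* Each term grows with [norm g]; passing to [Rg] makes the radius the same for all [g] in
       [Gt]. *)
    apply Rle_trans with (2 := Hbound b ltac:(lra)).
    assert (Hdng : delta * norm g <= delta * Rg) by (apply Rmult_le_compat_l; lra).
    assert (Hvg : forall k i, k = 2%nat \/ k = 3%nat -> i = 2%nat \/ i = 3%nat ->
      vdev ip T phi rho b (tb j) n k i (h j) g <= delta * Rg).
    { intros k i Hk Hi. apply Rle_trans with (2 := Hdng).
      apply (Hv j b); auto. lra. }
    repeat apply Rplus_le_compat; try apply Rle_refl.
    + assert (1 < exp (3 * rho * b)) by (rewrite -exp_0; apply exp_increasing; nra).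
      apply Rmult_le_compat_r.
      { repeat apply Rplus_le_le_0_compat; repeat apply Rmult_le_pos; fold q; lra. }
      apply Rmult_le_compat_l; [| exact HgR].
      pose proof (exp_pos (Rmax a 0 * b)). apply Rmult_le_pos; lra.
    + apply Rmult_le_compat_l; [pose proof (exp_pos (rho * b)); lra |].
      apply Rplus_le_compat_r. apply Qthr_le; lra.
    + repeat apply Rmax_lub; apply Hvg; auto.
Qed.
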